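(* Consider a spherical 4-bar linkage with sector angles $\alpha=\beta=\gamma=\delta\neq\pi/2$ (a ''rhombus''). (i) Finite solutions. There is a single branch of flexes, diffeomorphic to a circle $S^1$, with the parametrization $$x\in\mathbb{R}\cup\{\infty\},\quad y=\frac{\cos\alpha}{x},\quad z=x,\quad w=\frac{\cos\alpha}{x}.$$ (ii) Solutions at infinity. The solutions at infinity correspond to two distinct branches of simple folds, each diffeomorphic to a circle $S^1$: $$x\in\mathbb{R}\cup\{\infty\},\ y\equiv\infty,\ z=-x,\ w\equiv\infty\qquad\text{or}\qquad x\equiv\infty,\ y\in\mathbb{R}\cup\{\infty\},\ z\equiv\infty,\ w=-y.$$
   Context: A spherical 4-bar linkage (equivalently, a degree-4 single-vertex rigid origami) is a closed chain of four great-circle arcs on the unit sphere with lengths (sector angles), in counter-clockwise cyclic order, $\alpha,\beta,\gamma,\delta\in(0,\pi)$. Its configuration is described by the folding angles (signed turning angles between consecutive arcs) $\rho_x,\rho_y,\rho_z,\rho_w\in\mathbb{R}/2\pi$, where $\rho_x$ is at the joint of $\alpha$ and $\beta$, $\rho_y$ of $\beta$ and $\gamma$, $\rho_z$ of $\gamma$ and $\delta$, $\rho_w$ of $\delta$ and $\alpha$. Write $x=\tan(\rho_x/2)$, $y=\tan(\rho_y/2)$, $z=\tan(\rho_z/2)$, $w=\tan(\rho_w/2)$, all in $\mathbb{R}\cup\{\infty\}$, the one-point compactification of the real line (folding angles $\pi$ and $-\pi$ are identified and correspond to $\infty$). Finite solutions are the flexes found with $x,y,z,w$ finite, each branch then being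 completed over $\mathbb{R}\cup\{\infty\}$; solutions at infinity are those with some of $x,y,z,w$ equal to $\infty$. For real $c\neq0$, $c/0=\infty$ and $c/\infty=0$. *)

(* Defs.v *)
From mathcomp Require Import all_boot all_order all_algebra.
From mathcomp Require Import all_classical all_reals all_analysis.

Set Implicit Arguments.
Unset Strict Implicit.
Unset Printing Implicit Defensive.

Import Order.TTheory GRing.Theory Num.Theory.
Import numFieldNormedType.Exports.

Local Open Scope classical_set_scope.
Local Open Scope ring_scope.

(* Smooth maps between subsets of finite-dimensional spaces: a map on an
   arbitrary subset X is smooth when near each point of X it is the restriction
   of a map that is C^oo on an open set of the ambient space.  C^k is phrased
   with iterated directional derivatives; this is the usual notion only when V
   is finite-dimensional. *)
Section Smooth.
Context {R : realType}.

Fixpoint Ck_on {V W : normedModType R} (k : nat) (U : set V) (f : V -> W)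
    : Prop :=
  if k is k'.+1 then
    (forall v x, U x -> derivable f x v) /\
    (forall v, Ck_on k' U (fun x => 'D_v f x))
  else forall x, U x -> {for x, continuous f}.

Definition smooth_map_on {V W : normedModType R} (X : set V) (f : V -> W) :=
  forall x, X x -> exists (U : set V) (F : V -> W),
    [/\ open U, U x, (forall k, Ck_on k U F) &
        forall y, X y -> U y -> f y = F y].

Definition diffeomorphic {V W : normedModType R} (X : set V) (Y : set W) :=
  exists (f : V -> W) (g : W -> V),
    [/\ (forall p, X p -> Y (f p) /\ g (f p) = p),
        (forall q, Y q -> X (g q) /\ f (g q) = q),
        smooth_map_on X f &
        smooth_map_on Y g].

Definition unit_circle : set (R * R)%type :=
  [set p | p.1 ^+ 2 + p.2 ^+ 2 = 1].

End Smooth.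

Section Linkage.
Context {R : realType}.

(* A moving frame (p, t, n) on the unit sphere: position p, unit tangent t,
   and n = p x t, which points to the left of t seen from outside. *)
Definition frame : Type := ('rV[R]_3 * 'rV[R]_3 * 'rV[R]_3)%type.

Definition advance (a : R) (F : frame) : frame :=
  let: (p, t, n) := F in
  (cos a *: p + sin a *: t, cos a *: t - sin a *: p, n).

Definition turn (r : R) (F : frame) : frame :=
  let: (p, t, n) := F in
  (p, cos r *: t + sin r *: n, cos r *: n - sin r *: t).

Definition start_frame : frame :=
  (delta_mx 0 0, delta_mx 0 1, delta_mx 0 ord_max).

Definition closed_chain (alpha beta gamma delta rx ry rz rw : R) : Prop :=
  turn rw (advance delta (turn rz (advance gamma
    (turn ry (advance beta (turn rx (advance alpha start_frame))))))) =
  start_frame.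

(* None is the point at infinity; configurations carry the product topology. *)
Local Notation cline := (one_point_compactification R).
Local Notation config := (cline * cline * cline * cline)%type.

Definition cinfty : cline := None.

Definition half_tan (r : R) : cline :=
  if cos (r / 2) == 0 then cinfty else Some (tan (r / 2)).

Definition flexes (alpha beta gamma delta : R) : set config :=
  [set q | exists rx ry rz rw,
     closed_chain alpha beta gamma delta rx ry rz rw /\
     q = (half_tan rx, half_tan ry, half_tan rz, half_tan rw)].

Definition finite_flexes (alpha beta gamma delta : R) : set config :=
  flexes alpha beta gamma delta `&`
  [set q | let: (x, y, z, w) := q in
     [/\ x <> cinfty, y <> cinfty, z <> cinfty & w <> cinfty]].

Definition infinite_flexes (alpha beta gamma delta : R) : set config :=
  flexes alpha beta gamma delta `&`
  [set q | let: (x, y, z, w) := q in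
     [\/ x = cinfty, y = cinfty, z = cinfty | w = cinfty]].

Definition cdiv (c : R) (x : cline) : cline :=
  if x is Some t then if t == 0 then cinfty else Some (c / t) else Some 0.

Definition copp (x : cline) : cline :=
  if x is Some t then Some (- t) else cinfty.

Definition rhombus_branch (alpha : R) : set config :=
  range (fun x : cline => (x, cdiv (cos alpha) x, x, cdiv (cos alpha) x)).

Definition simple_fold_yw : set config :=
  range (fun x : cline => (x, cinfty, copp x, cinfty)).

Definition simple_fold_xz : set config :=
  range (fun y : cline => (cinfty, y, cinfty, copp y)).

(* The smooth structure on the compactified line is that of the circle of
   folding angles R/2pi: the value x = tan (rho / 2) is sent to
   (cos rho, sin rho). *)
Definition circle_point (x : cline) : R * R :=
  if x is Some t then ((1 - t ^+ 2) / (1 + t ^+ 2), (2 * t) / (1 + t ^+ 2))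
  else (-1, 0).

Definition config_point (q : config) : (R * R) * (R * R) * (R * R) * (R * R) :=
  let: (x, y, z, w) := q in
  (circle_point x, circle_point y, circle_point z, circle_point w).

Definition diffeomorphic_to_circle (B : set config) : Prop :=
  diffeomorphic (@unit_circle R) (config_point @` B).

End Linkage.

Arguments simple_fold_yw R : clear implicits.
Arguments simple_fold_xz R : clear implicits.

(* Main.v *)
Require Import Defs.
From mathcomp Require Import all_boot all_order all_algebra.
From mathcomp Require Import all_classical all_reals all_analysis.
From mathcomp Require Import ring lra.

Import Order.TTheory GRing.Theory Num.Theory.
Import numFieldNormedType.Exports.

Local Open Scope classical_set_scope.
Local Open Scope ring_scope.

(** Closing the rhombus means that the moving frame reached after two arcs
    equals the one obtained by walking the last two arcs backwards.  The nine
    scalar equations this gives force [cos rho_x = cos rho_z]; in half-tangents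
    the remaining ones reduce, when all joints are finite, to [x y = cos alpha],
    [z = x] and [z w = cos alpha], while an infinite joint forces its opposite
    joint to be infinite too and the other two to be mutually opposite.  The
    finite flexes are the image of the nonzero reals under the embedding
    [x |-> (x, c/x, x, c/x)] of the compactified line, which is compact, so their
    closure is the whole image.  In the coordinates [(cos rho, sin rho)] each
    branch is the graph of a rational map of the circle, and projection to one
    joint is the inverse. *)

(** * Smoothness of rational maps *)

Section SmoothnessCriteria.
Context {R : realType}.

(** Around each point of an open [U] the two maps agree nearby, hence so do their derivatives. This
    allows derivative formulas that hold only on [U]. *)
Lemma Ck_on_ext {V W : normedModType R} k (U : set V) (f g : V -> W) :
  open U -> (forall x, U x -> f x = g x) -> Ck_on k U f -> Ck_on k U g.
Proof.
elim: k f g => [|k IHk] f g oU fg /=.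
  move=> cf x Ux.
  suff : g y @[y --> x] --> g x by [].
  rewrite -(fg x Ux); apply: cvg_trans (cf x Ux); apply: near_eq_cvg.
  by apply: filterS (open_nbhs_nbhs (conj oU Ux)) => y /fg.
have fgn x : U x -> {near x, f =1 g}.
  by move=> Ux; apply: filterS (open_nbhs_nbhs (conj oU Ux)) => y /fg.
move=> [df Df]; split=> [v x Ux|v].
  by apply: near_eq_derivable (df v x Ux); exact: fgn.
by apply: IHk (Df v) => // x Ux; apply: near_eq_derive; exact: fgn.
Qed.

(** The difference quotient of a pair is the pair of difference quotients, so the limit is taken
    componentwise. *)
Lemma is_derive_pair {V W1 W2 : normedModType R} (f : V -> W1) (g : V -> W2)
    x v df dg :
  is_derive x v f df -> is_derive x v g dg ->
  is_derive x v (fun y => (f y, g y)) (df, dg).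
Proof.
move=> [cf <-] [cg <-].
have h : (fun h => h^-1 *: (((fun y => (f y, g y)) \o shift x) (h *: v)
    - (f x, g x))) @ 0^' --> ('D_v f x, 'D_v g x).
  exact: (cvg_pair cf cg).
by split; [apply/cvg_ex; eexists; exact: h | apply: cvg_lim h].
Qed.

Lemma Ck_on_pair {V W1 W2 : normedModType R} k (U : set V)
    (f : V -> W1) (g : V -> W2) :
  open U -> Ck_on k U f -> Ck_on k U g -> Ck_on k U (fun x => (f x, g x)).
Proof.
elim: k f g => [|k IHk] f g oU /=.
  by move=> cf cg x Ux; apply: (cvg_pair (cf x Ux) (cg x Ux)).
move=> [df Df] [dg Dg].
have dfg v x : U x ->
    is_derive x v (fun y => (f y, g y)) ('D_v f x, 'D_v g x).
  by move=> Ux; apply: is_derive_pair; apply: derivableP; [exact: df|exact: dg].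
split=> [v x /(dfg v) []//|v].
apply: Ck_on_ext (IHk _ _ oU (Df v) (Dg v)) => // x Ux.
by have [_ ->] := dfg v x Ux.
Qed.

Lemma Ck_on_cst {V W : normedModType R} k (U : set V) (a : W) :
  Ck_on k U (cst a : V -> W).
Proof.
elim: k a => [|k IHk] a /=; first by move=> x _; exact: cst_continuous.
split=> [v x _|v]; first exact: derivable_cst.
have -> : (fun x => 'D_v (cst a : V -> W) x) = cst 0.
  by apply/funext => x; exact: derive_cst.
exact: IHk.
Qed.

Lemma is_derive_linear {V W : normedModType R} (f : {linear V -> W}) x v :
  continuous f -> is_derive x v f (f v).
Proof.
move=> cf; have dx : differentiable f x by exact: linear_differentiable.
by split; [exact: diff_derivable|rewrite deriveE// diff_lin].
Qed.

Lemma linear_Ck_on {V W : normedModType R} k (U : set V)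
    (f : {linear V -> W}) : continuous f -> Ck_on k U f.
Proof.
move=> cf; case: k => [|k] /=; first by move=> x _; exact: cf.
split=> [v x _|v]; first by have [] := is_derive_linear f x v cf.
have -> : (fun x => 'D_v f x) = cst (f v).
  by apply/funext => x; have [_] := is_derive_linear f x v cf.
exact: Ck_on_cst.
Qed.

(** A class generated by operations under which it stays closed for directional derivatives;
    smoothness of all orders then needs no computation of higher derivatives. *)
Inductive rational_on {V : normedModType R} (U : set V) : (V -> R) -> Prop :=
| rational_cst c : rational_on U (cst c)
| rational_linear (f : {linear V -> R^o}) :
    continuous f -> rational_on U f
| rational_add f g : rational_on U f -> rational_on U g ->
    rational_on U (fun x => f x + g x)
| rational_mul f g : rational_on U f -> rational_on U g ->
    rational_on U (fun x => f x * g x)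
| rational_inv f : rational_on U f -> (forall x, U x -> f x != 0) ->
    rational_on U (fun x => (f x)^-1).

Lemma rational_on_continuous {V : normedModType R} (U : set V) f :
  rational_on U f -> forall x, U x -> {for x, continuous f}.
Proof.
elim=> {f} [c|f cf|f g _ cf _ cg|f g _ cf _ cg|f _ cf f0] x Ux.
- exact: cst_continuous.
- exact: cf.
- by apply: cvgD; [exact: cf|exact: cg].
- by apply: cvgM; [exact: cf|exact: cg].
- by apply: cvgV; [exact: f0|exact: cf].
Qed.

Lemma rational_on_derive {V : normedModType R} (U : set V) f v :
  rational_on U f -> exists2 df, rational_on U df &
    forall x, U x -> is_derive x v (f : V -> R^o) (df x).
Proof.
elim=> {f} [c|f cf|f g Qf [df Qdf fdf] Qg [dg Qdg gdg]
    |f g Qf [df Qdf fdf] Qg [dg Qdg gdg]|f Qf [df Qdf fdf] f0].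
- by exists (cst 0); [exact: rational_cst|move=> x _; exact: is_derive_cst].
- exists (cst (f v)) => [|x _]; first exact: rational_cst.
  exact: is_derive_linear.
- exists (fun x => df x + dg x) => [|x Ux]; first exact: rational_add.
  by apply: is_deriveD; [exact: fdf|exact: gdg].
- exists (fun x => f x * dg x + g x * df x) => [|x Ux].
    by apply: rational_add; exact: rational_mul.
  by apply: is_deriveM; [exact: fdf|exact: gdg].
(* The derivative of an inverse, spelled with the constructors of the class only. *)
- exists (fun x => -1 * ((f x)^-1 * (f x)^-1) * df x) => [|x Ux].
    do ?apply: rational_mul => //; first exact: rational_cst.
    + exact: rational_inv.
    + exact: rational_inv.
  have [dx <-] := fdf x Ux; split; first exact: derivableV (f0 x Ux) dx.
  by rewrite deriveV ?f0// mulN1r -invfM expr2.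
Qed.

Lemma rational_sub {V : normedModType R} (U : set V) f g :
  rational_on U f -> rational_on U g -> rational_on U (fun x => f x - g x).
Proof.
move=> Qf Qg; under eq_fun do rewrite -mulN1r.
by apply: rational_add => //; apply: rational_mul => //; exact: rational_cst.
Qed.

(** Induction on [k] for all [f] at once: each derivative agrees on [U] with another member of the
    class. *)
Lemma rational_on_Ck {V : normedModType R} k (U : set V) f :
  open U -> rational_on U f -> Ck_on k U (f : V -> R^o).
Proof.
move=> oU; elim: k f => [|k IHk] f Qf /=; first exact: rational_on_continuous.
split=> [v x Ux|v]; have [df Qdf fdf] := rational_on_derive U f v Qf.
  by have [] := fdf x Ux.
apply: Ck_on_ext (IHk df Qdf) => // x Ux.
by have [_ ->] := fdf x Ux.
Qed.

Lemma smooth_on_open {V W : normedModType R} (U X : set V) (f : V -> W) :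
  open U -> X `<=` U -> (forall k, Ck_on k U f) -> smooth_map_on X f.
Proof. by move=> oU XU Uf x Xx; exists U, f; split=> //; exact: XU. Qed.

End SmoothnessCriteria.

(** * The compactified line *)

Lemma hausdorff_prod {T U : topologicalType} :
  hausdorff_space T -> hausdorff_space U -> hausdorff_space (T * U)%type.
Proof.
move=> hT hU [a b] [c d] cl; congr pair.
- apply: hT => A B nA nB.
  have [[y z] [Ay By]] := cl _ _ (cvg_fst nA) (cvg_fst nB).
  by exists y.
- apply: hU => A B nA nB.
  have [[y z] [Ay By]] := cl _ _ (cvg_snd nA) (cvg_snd nB).
  by exists z.
Qed.

(** The range is compact, hence closed in a Hausdorff space, which bounds the closure; conversely
    continuity carries density of [D] to the range. *)
Lemma closure_compact_image {T U : topologicalType} (f : T -> U) (D : set T) :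
  compact [set: T] -> hausdorff_space U -> continuous f ->
  closure D = setT -> closure (f @` D) = range f.
Proof.
move=> cT hU cf dD; apply/seteqP; split.
  have /closure_id -> : closed (range f).
    apply: compact_closed => //; apply: continuous_compact => //.
    exact: continuous_subspaceT.
  by apply: closure_subset => _ [x _ <-]; exists x.
move=> _ [x _ <-] A nA.
have [y [Dy Ay]] : D `&` f @^-1` A !=set0.
  by have : closure D x by [rewrite dD]; apply; exact: cf.
by exists (f y); split=> //; exists y.
Qed.

Section CompactifiedLine.
Context {R : realType}.
Local Notation cline := (one_point_compactification R).

Lemma cline_hausdorff : hausdorff_space cline.
Proof.
apply: one_point_compactification_hausdorff; last exact: Rhausdorff.
exact: locally_compactR.
Qed.

Lemma cline_nbhs_infty (A : set cline) (M : R) :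
  A None -> (forall t, M < `|t| -> A (Some t)) -> nbhs (None : cline) A.
Proof.
move=> A0 At; exists `[- M, M]%classic.
  by split; [exact: segment_compact|exact: interval_closed].
move=> _ [[t /= tM <-]|->//]; apply: At; rewrite ltNge ler_norml.
by apply/negP => tM'; apply: tM; rewrite in_itv.
Qed.

Lemma cline_nbhs_infty_bounded (A : set cline) : nbhs (None : cline) A ->
  exists2 M : R, 0 < M & forall t, M < `|t| -> A (Some t).
Proof.
move=> [K [cK _] KA].
have [M [_ KM]] := compact_bounded cK.
(* Any number above [M] bounds [K], but [M] may be negative; this one is above [M] and positive. *)
exists (`|M| + 1) => [|t tM]; first by rewrite ltr_pwDr.
apply: KA; left; exists t => // Kt.
have := KM (`|M| + 1) _ t Kt.
rewrite (le_lt_trans (ler_norm M)) ?ltrDl// => /(_ isT) /=.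
by rewrite real_leNgt ?num_real// tM.
Qed.

Lemma cdiv_continuous (c : R) : c != 0 -> continuous (cdiv c : cline -> cline).
Proof.
move=> c0 [t|] A.
- rewrite /cdiv; case: eqP => [->|/eqP t0] nA.
  + have [M M0 MA] := cline_nbhs_infty_bounded _ nA.
    (* At [0] the value is infinity: [|u| < |c| / M] forces [|c / u| > M]. *)
    have cM : 0 < `|c| / M by rewrite divr_gt0 ?normr_gt0.
    rewrite /nbhs /= /nbhs /=.
    apply/nbhs_ballP; exists (`|c| / M) => //= u.
    rewrite /ball/= sub0r normrN => uc.
    case: eqP => [_|/eqP u0]; first exact: nbhs_singleton nA.
    apply: MA; rewrite normrM normfV ltr_pdivlMr ?normr_gt0//.
    by rewrite mulrC -ltr_pdivlMr.
  + have cd : {for t, continuous (fun u : R => c / u)}.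
      by apply: cvgM; [exact: cvg_cst|apply: cvgV].
    have := cd _ nA; rewrite /nbhs /= => nB.
    near=> u.
    have u0 : u != 0 by near: u; exact: (cvgr_neq0 (f := id) t cvg_id).
    by rewrite /= (negbTE u0); near: u.
- move=> nA; have := nA; rewrite /cdiv {1}/nbhs /= => /nbhs_ballP[e /= e0 eA].
  (* Dually, at infinity the value is [0], and [|t| > |c| / e] forces [|c / t| < e]. *)
  apply: (cline_nbhs_infty _ (`|c| / e)) => [|t].
    exact: nbhs_singleton nA.
  move=> ct.
  have t0 : 0 < `|t| by apply: le_lt_trans ct; rewrite divr_ge0// ltW.
  rewrite /= -normr_eq0 gt_eqF//; apply: eA.
  rewrite /ball/= sub0r normrN normrM normfV ltr_pdivrMr//.
  by rewrite mulrC -ltr_pdivrMr.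
Unshelve. all: by end_near. Qed.

(** Only [0] and infinity are left out, and both are limits of nonzero reals. *)
Lemma cline_nonzero_dense :
  closure [set x : cline | exists2 t : R, t != 0 & x = Some t] = setT.
Proof.
rewrite -subTset => -[t|] _ A nA.
- have [t0|t0] := eqVneq t 0.
    subst t.
    move: nA; rewrite /nbhs /= => /nbhs_ballP[e /= e0 eA].
    exists (Some (e / 2)); split.
      by exists (e / 2) => //; rewrite gt_eqF// divr_gt0.
    apply: eA; rewrite /ball/= sub0r normrN gtr0_norm ?divr_gt0//.
    by rewrite ltr_pdivrMr// ltr_pMr// ltr1n.
  by exists (Some t); split; [exists t|exact: nbhs_singleton nA].
- have [M M0 MA] := cline_nbhs_infty_bounded _ nA.
  exists (Some (M + 1)); split.
    by exists (M + 1) => //; rewrite gt_eqF// addr_gt0.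
  by apply: MA; rewrite gtr0_norm ?addr_gt0// ltrDl.
Qed.

Lemma rhombus_branch_closure (alpha : R) : cos alpha != 0 ->
  closure [set q | exists2 t : R, t != 0 &
    q = (Some t : cline, Some (cos alpha / t) : cline,
         Some t : cline, Some (cos alpha / t) : cline)] =
  rhombus_branch alpha.
Proof.
move=> c0; rewrite /rhombus_branch -(closure_compact_image _ _ _ _ _
  cline_nonzero_dense).
- congr closure; apply/seteqP; split => [_ [t t0 ->]|_ [_ [t t0 ->] <-]].
    by exists (Some t); [exists t|rewrite /cdiv (negbTE t0)].
  by exists t => //; rewrite /cdiv (negbTE t0).
- exact: one_point_compactification_compact.
- by do ?apply: hausdorff_prod; exact: cline_hausdorff.
- move=> x; have cx := cdiv_continuous _ c0 x.
  exact: (cvg_pair (cvg_pair (cvg_pair cvg_id cx) cvg_id) cx).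
Qed.
End CompactifiedLine.

(** * Closure equations *)

Section Flexes.
Context {R : realType}.
Local Notation cline := (one_point_compactification R).
Implicit Types (a b c d e f r s t u : R) (x y z w : cline).

Definition row3 a b c : 'rV[R]_3 := \row_j nth 0 [:: a; b; c] j.

Lemma row3_eqE a b c d e f :
  (row3 a b c = row3 d e f) = [/\ a = d, b = e & c = f].
Proof.
apply/propext; split=> [/rowP E|[-> -> ->]//].
by have := (E 0, E 1, E ord_max); rewrite !mxE /= => -[[-> ->] ->].
Qed.

Lemma scale_row3 a b c d : d *: row3 a b c = row3 (d * a) (d * b) (d * c).
Proof. by apply/rowP => -[[|[|[|//]]] i]; rewrite !mxE. Qed.

Lemma add_row3 a b c d e f :
  row3 a b c + row3 d e f = row3 (a + d) (b + e) (c + f).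
Proof. by apply/rowP => -[[|[|[|//]]] i]; rewrite !mxE. Qed.

Lemma opp_row3 a b c : - row3 a b c = row3 (- a) (- b) (- c).
Proof. by apply/rowP => -[[|[|[|//]]] i]; rewrite !mxE. Qed.

Lemma start_frame_row3 :
  start_frame = (row3 1 0 0, row3 0 1 0, row3 0 0 1) :> frame.
Proof.
by congr (_, _, _); apply/rowP => -[[|[|[|//]]] i]; rewrite !mxE.
Qed.

Lemma advanceK a : cancel (@advance R a) (advance (- a)).
Proof.
move=> [[p t] n] /=; rewrite cosN sinN; congr (_, _, _); apply/rowP => j;
  rewrite !mxE; ring: (cos2sin2 a).
Qed.

Lemma advanceNK a : cancel (@advance R (- a)) (advance a).
Proof. by move=> F; rewrite -[X in advance X (advance _ _)]opprK advanceK. Qed.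

Lemma turnK a : cancel (@turn R a) (turn (- a)).
Proof.
move=> [[p t] n] /=; rewrite cosN sinN; congr (_, _, _); apply/rowP => j;
  rewrite !mxE; ring: (cos2sin2 a).
Qed.

Lemma turnNK a : cancel (@turn R (- a)) (turn a).
Proof. by move=> F; rewrite -[X in turn X (turn _ _)]opprK turnK. Qed.

(* Each of [X], [Y], [Z], [W] stands for the cosine and sine of a folding
   angle, and [c], [s] for those of the common sector angle: the frame after
   the first two arcs is compared with the one obtained by walking the last two
   arcs backwards. *)
Definition rhombus_closed c s (X Y Z W : R * R) : Prop :=
  let: (cx, sx) := X in let: (cy, sy) := Y in
  let: (cz, sz) := Z in let: (cw, sw) := W in
  [/\ [/\ s ^+ 2 * cx = s ^+ 2 * cz,
          s * (c * (1 + cx)) = s * (sz * sw - c * cw * (1 + cz)) &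
          s * sx = s * (c * sw * (1 + cz) + sz * cw)],
      [/\ s * (sy * sx - cy * c * (1 + cx)) = s * (c * (1 + cz)),
          cy * (c ^+ 2 * cx - s ^+ 2) - sy * c * sx =
            c * (cz * c * cw - sz * sw) - s ^+ 2 * cw &
          cy * c * sx + sy * cx =
            s ^+ 2 * sw - c * (cz * c * sw + sz * cw)] &
      [/\ s * (cy * sx + sy * c * (1 + cx)) = s * sz,
          sy * (s ^+ 2 - c ^+ 2 * cx) - cy * c * sx = cz * sw + sz * c * cw &
          cy * cx - sy * c * sx = cz * cw - sz * c * sw]].

Lemma frame_eqE (F G : @frame R) :
  F = G <-> [/\ F.1.1 = G.1.1, F.1.2 = G.1.2 & F.2 = G.2].
Proof.
by split=> [->//|]; move: F G => [[? ?] ?] [[? ?] ?] /= [-> -> ->].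
Qed.

Lemma closed_chainE a rx ry rz rw :
  closed_chain a a a a rx ry rz rw <->
  rhombus_closed (cos a) (sin a) (cos rx, sin rx) (cos ry, sin ry)
    (cos rz, sin rz) (cos rw, sin rw).
Proof.
(* Moving four of the eight rotations to the other side keeps the degree of the scalar equations
   low. *)
transitivity (turn ry (advance a (turn rx (advance a start_frame))) =
  advance (- a) (turn (- rz) (advance (- a) (turn (- rw) start_frame)))).
  rewrite /closed_chain; split=> [E|->].
    by rewrite -[in RHS]E !(advanceK, turnK).
  by rewrite !(advanceNK, turnNK).
rewrite start_frame_row3 /= !(cosN, sinN) frame_eqE /=.
rewrite !(scale_row3, opp_row3, add_row3) !row3_eqE.
by split=> -[[? ? ?] [? ? ?] [? ? ?]]; split; split; lra.
Qed.

Lemma one_add_sqr_neq0 t : 1 + t ^+ 2 != 0.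
Proof. by rewrite gt_eqF// ltr_pwDl// sqr_ge0. Qed.

(** These are the double-angle formulas; [cos (r / 2) = 0] gives [(-1, 0)], the point assigned to
    infinity. *)
Lemma circle_point_half_tan r : circle_point (half_tan r) = (cos r, sin r).
Proof.
have r2 : r = (r / 2) *+ 2 by rewrite -mulr_natr divfK.
rewrite /half_tan [in RHS]r2 cos_mulr2n sin_mulr2n.
have := cos2Dsin2 (r / 2); set C := cos (r / 2); set S := sin (r / 2) => CS.
case: eqP => [C0|/eqP C0]; rewrite /circle_point.
  by rewrite C0 expr0n/= mul0rn sub0r mul0r mul0rn.
have SE : S ^+ 2 = 1 - C ^+ 2 by rewrite -CS; ring.
have D : 1 + (S / C) ^+ 2 = (C ^+ 2)^-1.
  by rewrite expr_div_n SE; field.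
rewrite /tan -/C -/S D invrK; congr pair; first by rewrite expr_div_n SE; field.
by field.
Qed.

Lemma half_tan_surj x : exists r, half_tan r = x.
Proof.
case: x => [t|]; last by exists pi; rewrite /half_tan cos_pihalf eqxx.
exists (atan t * 2); rewrite /half_tan mulfK ?pnatr_eq0// atanK.
by rewrite gt_eqF// cos_gt0_pihalf// atan_gtNpi2 atan_ltpi2.
Qed.

(** One plus the first coordinate is [2 / (1 + t ^+ 2)], nonzero for finite [t] and zero at
    infinity; dividing the second coordinate by it recovers [t]. *)
Lemma circle_point_inj : injective (@circle_point R).
Proof.
have D := one_add_sqr_neq0.
have D1 t : 1 + (1 - t ^+ 2) / (1 + t ^+ 2) = 2 / (1 + t ^+ 2) :> R by field.
move=> [t|] [u|] //= [E1 E2].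
- have k : 2 / (1 + t ^+ 2) = 2 / (1 + u ^+ 2) by rewrite -!D1 E1.
  congr Some; move: E2; rewrite -!mulrA ![t * _]mulrC ![u * _]mulrC !mulrA k.
  by apply: mulfI; rewrite mulf_neq0 ?invr_eq0 ?pnatr_eq0.
- have := D1 t; rewrite E1 subrr => /esym/eqP.
  by rewrite mulf_eq0 invr_eq0 pnatr_eq0 (negbTE (D t)).
- have := D1 u; rewrite -E1 subrr => /esym/eqP.
  by rewrite mulf_eq0 invr_eq0 pnatr_eq0 (negbTE (D u)).
Qed.

(** Closure sees the folding angles only through their cosines and sines, which the half-tangents
    determine. *)
Lemma flexesE a x y z w : flexes a a a a (x, y, z, w) <->
  rhombus_closed (cos a) (sin a) (circle_point x) (circle_point y)
    (circle_point z) (circle_point w).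
Proof.
split=> [[rx [ry [rz [rw [/closed_chainE cl [-> -> -> ->]]]]]]|].
  by rewrite !circle_point_half_tan; exact: cl.
have [rx <-] := half_tan_surj x; have [ry <-] := half_tan_surj y.
have [rz <-] := half_tan_surj z; have [rw <-] := half_tan_surj w.
rewrite !circle_point_half_tan => /closed_chainE cl.
by exists rx, ry, rz, rw; split; first exact: cl.
Qed.

(* Unqualified, [copp] is the opposite of a charge. *)
Lemma circle_point_copp x :
  circle_point (Defs.copp x) = ((circle_point x).1, - (circle_point x).2).
Proof. by case: x => [t|] /=; rewrite ?oppr0// sqrrN mulrN mulNr. Qed.

(** Here [k] is one plus the cosine. Naming it removes fractions: the closure equations become
    polynomial and [k] can be cancelled. *)
Lemma circle_point_Some t : exists k, [/\ k != 0, k * (1 + t ^+ 2) = 2 &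
  circle_point (Some t) = (k - 1, t * k)].
Proof.
have D := one_add_sqr_neq0 t.
exists (2 / (1 + t ^+ 2)); split; first by rewrite mulf_neq0 ?invr_eq0 ?pnatr_eq0.
  by rewrite divfK.
by congr pair; field.
Qed.

(** The first closure equation equates the cosines at [x] and [z], so these are both finite or both
    infinite. The cases then follow which of [y] and [w] are finite. *)
Lemma rhombus_closedP c s x y z w :
    c != 0 -> s != 0 -> s ^+ 2 = 1 - c ^+ 2 ->
  rhombus_closed c s (circle_point x) (circle_point y)
    (circle_point z) (circle_point w) <->
  [\/ exists2 t, t != 0 &
        [/\ x = Some t, y = Some (c / t), z = Some t & w = Some (c / t)],
      [/\ y = None, z = Defs.copp x & w = None] |
      [/\ x = None, z = None & w = Defs.copp y]].
Proof.
move=> c0 s0 s2; have ss0 := expf_neq0 2 s0; split; last first.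
  case=> [[t t0 [-> -> -> ->]]|[-> -> ->]|[-> -> ->]].
  - have Dt := one_add_sqr_neq0 t.
    have Dct : t ^+ 2 + c ^+ 2 != 0.
      by rewrite gt_eqF// ltr_pwDl ?sqr_ge0// exprn_even_gt0.
    rewrite /rhombus_closed/= s2; split; split; field; by rewrite ?Dt ?Dct ?t0.
  - rewrite circle_point_copp; case: (circle_point x) => cx sx.
    by rewrite /rhombus_closed/= s2; split; split; ring.
  - rewrite circle_point_copp; case: (circle_point y) => cy sy.
    by rewrite /rhombus_closed/= s2; split; split; ring.
case: x => [t|].
  have [k [k0 kt ->]] := circle_point_Some t.
  case: z => [u|]; last first.
    case: (circle_point y) (circle_point w) => cy sy [cw sw].
    by case=> -[/(mulfI ss0)/eqP]; rewrite subr_eq addNr (negbTE k0).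
  have [l [l0 lu ->]] := circle_point_Some u.
  case: y => [q|].
    have [j [j0 jq ->]] := circle_point_Some q.
    case: w => [v|].
      have [m [m0 mv ->]] := circle_point_Some v.
      case=> -[/(mulfI ss0) P0 /(mulfI s0) P1 /(mulfI s0) P2]
        [/(mulfI s0) T0 _ _] _.
      have kl : k = l by move: P0 => /addIr.
      subst l.
      have cuv : c = u * v.
        by apply: (mulfI (mulf_neq0 k0 m0)); lra.
      (* Substituting [c = u * v] in [P2] leaves [t = u * (m * (1 + v ^+ 2)) - u], and the bracket
         is [2]. *)
      have tu : t = u.
        apply: (mulfI k0); transitivity (k * (u * (m * (1 + v ^+ 2)) - u)).
          by rewrite [k * t]mulrC P2 cuv; ring.
        by rewrite mv; ring.
      subst u; have ctq : c = t * q.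
        by apply: (mulfI (mulf_neq0 k0 j0)); lra.
      have t0 : t != 0 by apply: contraNneq c0 => t0; rewrite ctq t0 mul0r.
      constructor 1; exists t => //.
      split=> //; congr Some.
        by rewrite ctq mulrAC divff ?mul1r.
      by rewrite cuv mulrAC divff ?mul1r.
    case=> -[/(mulfI ss0) P0 _ /(mulfI s0) P2] [/(mulfI s0) T0 _ _]
      [/(mulfI s0) N0 _ _].
    (* With only [w] infinite, [t = - (q * c)] and [q * t = c] would give [c = - (c * q ^+ 2)]. *)
    exfalso; have kl : k = l by move: P0 => /addIr.
    subst l.
    have tqc : t = - (q * c).
      by apply: (mulfI (mulf_neq0 k0 j0)); move: P2 N0 => /=; lra.
    have qtc : q * t = c.
      by apply: (mulfI (mulf_neq0 k0 j0)); move: T0 => /=; lra.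
    suff : c * (1 + q ^+ 2) = 0.
      by move/eqP; rewrite mulf_eq0 (negbTE c0) (negbTE (one_add_sqr_neq0 _)).
    by rewrite mulrDr mulr1 -{1}qtc tqc; ring.
  case: w => [v|].
    have [m [m0 mv ->]] := circle_point_Some v.
    case=> -[/(mulfI ss0) P0 /(mulfI s0) P1 /(mulfI s0) P2] _
        [/(mulfI s0) N0 _ _].
    (* The mirror case, with only [y] infinite, fails in the same way. *)
    exfalso; have kl : k = l by move: P0 => /addIr.
    subst l.
    have ut : u = - t by apply: (mulfI k0); move: N0 => /=; lra.
    subst u.
    have ctv : c = - (t * v).
      by apply: (mulfI (mulf_neq0 k0 m0)); lra.
    have cvt : c * v = t.
      by apply: (mulfI (mulf_neq0 k0 m0)); lra.
    suff : c * (1 + v ^+ 2) = 0.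
      by move/eqP; rewrite mulf_eq0 (negbTE c0) (negbTE (one_add_sqr_neq0 _)).
    by rewrite mulrDr mulr1 {1}ctv -cvt; ring.
  case=> -[/(mulfI ss0) P0 _ _] _ [/(mulfI s0) N0 _ _].
  have kl : k = l by move: P0 => /addIr.
  subst l; constructor 2; split=> //=; congr Some.
  by apply: (mulfI k0); move: N0 => /=; lra.
case: z => [u|]; last first.
  move Ey : (circle_point y) => [cy sy]; move Ew : (circle_point w) => [cw sw].
  (* With both cosines equal to [-1], the coefficient of [sy] in [N1] is [s ^+ 2 + c ^+ 2 = 1], so
     the points of [y] and [w] are mirror images. *)
  rewrite /= s2 => -[_ _ [_ N1 N2]]; constructor 3; split=> //.
  apply: circle_point_inj; rewrite circle_point_copp Ey Ew /=.
  by congr pair; lra.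
have [l [l0 lu ->]] := circle_point_Some u.
case: (circle_point y) (circle_point w) => cy sy [cw sw].
case=> -[/(mulfI ss0)/eqP]; rewrite /= eq_sym subr_eq addNr => /eqP l00.
by rewrite l00 eqxx in l0.
Qed.
End Flexes.

(** * The branches are circles *)

Section Circles.
Context {R : realType}.
Local Notation cline := (one_point_compactification R).

Lemma unit_circle_range : @unit_circle R = range circle_point.
Proof.
apply/seteqP; rewrite /unit_circle; split=> [[a b] /= ab|_ [x _ <-]]; last first.
  have [r <-] := half_tan_surj x.
  by rewrite circle_point_half_tan/= cos2Dsin2.
have [a1|a1] := eqVneq (1 + a) 0.
  have aE : a = -1 by lra.
  have : b ^+ 2 = 0 by rewrite aE in ab; lra.
  by move=> /eqP; rewrite sqrf_eq0 => /eqP ->; exists None => //=; rewrite aE.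
have t2 : (b / (1 + a)) ^+ 2 = (1 - a) / (1 + a).
  have -> : 1 - a = b ^+ 2 / (1 + a).
    by apply/(canRL (mulfK a1)); move: ab; lra.
  by field.
(* Stereographic projection from [(-1, 0)]. *)
exists (Some (b / (1 + a))) => //=; rewrite t2.
by congr pair; field; rewrite a1 /=; apply/eqP; lra.
Qed.

(** Since [circle_point] sweeps out the whole circle, inverse identities need checking only on
    points of the compactified line. *)
Lemma diffeomorphic_to_circleP (psi : cline -> cline * cline * cline * cline)
    (f : R * R -> (R * R) * (R * R) * (R * R) * (R * R))
    (g : (R * R) * (R * R) * (R * R) * (R * R) -> R * R) :
  (forall x, f (circle_point x) = config_point (psi x)) ->
  (forall x, g (config_point (psi x)) = circle_point x) ->
  smooth_map_on (@unit_circle R) f ->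
  (forall k, Ck_on k setT g) ->
  diffeomorphic_to_circle (range psi).
Proof.
move=> fE gE sf sg; exists f, g; split=> //.
- rewrite unit_circle_range => _ [x _ <-]; rewrite fE gE; split=> //.
  by exists (psi x) => //; exists x.
- move=> _ [_ [x _ <-] <-]; rewrite gE fE; split=> //.
  by rewrite unit_circle_range; exists x.
- by apply: smooth_on_open sg => //; exact: openT.
Qed.

Lemma fst_rational (U : set (R * R)) : rational_on U fst.
Proof. by apply: (rational_linear U fst) => x; exact: cvg_fst. Qed.

Lemma snd_rational (U : set (R * R)) : rational_on U snd.
Proof. by apply: (rational_linear U snd) => x; exact: cvg_snd. Qed.

Lemma id_Ck k (U : set (R * R)) : Ck_on k U (fun p => p).
Proof. by apply: (linear_Ck_on k U idfun) => x; exact: cvg_id. Qed.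

Lemma reflection_Ck k : Ck_on k setT (fun p : R * R => (p.1, 0 - p.2)).
Proof.
apply: Ck_on_pair; [exact: openT|apply: rational_on_Ck; first exact: openT..].
  exact: fst_rational.
by apply: rational_sub; [exact: rational_cst|exact: snd_rational].
Qed.

Lemma first_coordinate_Ck k :
  Ck_on k setT (fst \o fst \o fst :
    (R * R) * (R * R) * (R * R) * (R * R) -> R * R).
Proof.
apply: (linear_Ck_on k setT (fst \o fst \o fst)) => x.
apply: continuous_comp; first exact: cvg_fst.
by apply: continuous_comp; exact: cvg_fst.
Qed.

Lemma second_coordinate_Ck k :
  Ck_on k setT (snd \o fst \o fst :
    (R * R) * (R * R) * (R * R) * (R * R) -> R * R).
Proof.
apply: (linear_Ck_on k setT (snd \o fst \o fst)) => x.
apply: continuous_comp; first exact: cvg_fst.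
by apply: continuous_comp; [exact: cvg_fst|exact: cvg_snd].
Qed.

Lemma simple_fold_yw_circle : diffeomorphic_to_circle (simple_fold_yw R).
Proof.
apply: (diffeomorphic_to_circleP _
  (fun p => (p, (-1, 0), (p.1, 0 - p.2), (-1, 0)))
  (fst \o fst \o fst)).
- by move=> x; rewrite /= circle_point_copp sub0r.
- by [].
- apply: (smooth_on_open setT) => //; first exact: openT.
  move=> k.
  have cst_Ck : Ck_on k setT (cst (-1, 0) : R * R -> R * R) by exact: Ck_on_cst.
  have re_Ck := reflection_Ck k; have idk := id_Ck k setT.
  by do 3![apply: Ck_on_pair; [exact: openT| |exact]].
- exact: first_coordinate_Ck.
Qed.

Lemma simple_fold_xz_circle : diffeomorphic_to_circle (simple_fold_xz R).
Proof.
apply: (diffeomorphic_to_circleP _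
  (fun p => ((-1, 0), p, (-1, 0), (p.1, 0 - p.2)))
  (snd \o fst \o fst)).
- by move=> x; rewrite /= circle_point_copp sub0r.
- by [].
- apply: (smooth_on_open setT) => //; first exact: openT.
  move=> k.
  have cst_Ck : Ck_on k setT (cst (-1, 0) : R * R -> R * R) by exact: Ck_on_cst.
  have re_Ck := reflection_Ck k; have idk := id_Ck k setT.
  by do 3![apply: Ck_on_pair; [exact: openT| |exact]].
- exact: second_coordinate_Ck.
Qed.

Lemma rhombus_branch_circle (alpha : R) : cos alpha != 0 ->
  diffeomorphic_to_circle (rhombus_branch alpha).
Proof.
set c := cos alpha => c0.
(* For [y = c / x] the cosine and sine are [(x^2 - c^2) / (x^2 + c^2)] and [2 c x / (x^2 + c^2)];
   inserting [x = p.2 / (1 + p.1)] and [x^2 = (1 - p.1) / (1 + p.1)] gives [Y], which also covers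
   [x] infinite. *)
pose D (p : R * R) := (1 - p.1) + c ^+ 2 * (1 + p.1).
pose Y (p : R * R) := (((1 - p.1) - c ^+ 2 * (1 + p.1)) / D p, 2 * c * p.2 / D p).
have D1 U : rational_on U (fun p : R * R => 1 - p.1).
  by apply: rational_sub; [exact: rational_cst|exact: fst_rational].
have D2 U : rational_on U (fun p : R * R => c ^+ 2 * (1 + p.1)).
  apply: rational_mul; first exact: rational_cst.
  by apply: rational_add; [exact: rational_cst|exact: fst_rational].
have QD U : rational_on U D by apply: rational_add.
have oD : open [set p | D p != 0].
  apply: (@open_comp _ _ D [set x | x != 0]); last exact: open_neq.
  by move=> p _; apply: (rational_on_continuous setT D).
apply: (diffeomorphic_to_circleP _ (fun p => (p, Y p, p, Y p))
  (fst \o fst \o fst)).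
- move=> [t|] /=.
    have Dt := one_add_sqr_neq0 t.
    have Dct : t ^+ 2 + c ^+ 2 != 0.
      by rewrite gt_eqF// ltr_wpDl ?sqr_ge0// exprn_even_gt0.
    have -> : circle_point (cdiv c (Some t)) = 
       Y ((1 - t ^+ 2) / (1 + t ^+ 2), 2 * t / (1 + t ^+ 2)).
      rewrite /Y /D /cdiv /=; case: eqP => [->|/eqP t0] /=.
        by congr pair; field.
      have E : 1 + t ^+ 2 - (1 - t ^+ 2) +
          c ^+ 2 * (1 + t ^+ 2 + (1 - t ^+ 2)) = 2 * (t ^+ 2 + c ^+ 2) by ring.
      by congr pair; field; rewrite E ?Dt ?Dct ?t0 mulf_neq0 ?pnatr_eq0.
    by [].
  have -> : Y (-1, 0) = (1, 0).
    by rewrite /Y /D/=; congr pair; field.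
  by rewrite expr0n /= mulr0 mul0r subr0 addr0 divr1.
- by [].
- apply: (smooth_on_open _ _ _ oD).
    rewrite unit_circle_range => _ [x _ <-].
    have [r <-] := half_tan_surj x; rewrite circle_point_half_tan /D /=.
    have c2 : 0 < c ^+ 2 by rewrite exprn_even_gt0.
    have := cos_le1 r; have := cos_geN1 r => lo hi.
    (* Both summands of [D] are nonnegative; the first vanishes only for [cos r = 1], where the
       second is [2 * c ^+ 2]. *)
    rewrite gt_eqF//; have [r1|r1] := ltrP (cos r) 1; last first.
      by have -> : cos r = 1 by [lra]; lra.
    by rewrite ltr_pwDl ?subr_gt0// mulr_ge0 ?(ltW c2)//; lra.
  move=> k.
  have idk := id_Ck k [set p | D p != 0].
  have Y_Ck : Ck_on k [set p | D p != 0] Y.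
    apply: Ck_on_pair => //; apply: rational_on_Ck => //;
      (apply: rational_mul; last exact: rational_inv).
      exact: rational_sub.
    by apply: rational_mul; [exact: rational_cst|exact: snd_rational].
  (* Made opaque, [Y] is not itself split into components and [Y_Ck] applies. *)
  clearbody Y; by do !apply: Ck_on_pair.
- exact: first_coordinate_Ck.
Qed.
End Circles.

(** * Classification of the flexes of the rhombus *)

Theorem mainTheorem3 (R : realType) (alpha beta gamma delta : R)
    (alpha_range : 0 < alpha < pi) (beta_range : 0 < beta < pi)
    (gamma_range : 0 < gamma < pi) (delta_range : 0 < delta < pi)
    (eq_ab : alpha = beta) (eq_bc : beta = gamma) (eq_cd : gamma = delta)
    (alpha_neq : alpha <> pi / 2) :
  [/\ closure (finite_flexes alpha beta gamma delta) = rhombus_branch alpha,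
      rhombus_branch alpha `<=` flexes alpha beta gamma delta &
      diffeomorphic_to_circle (rhombus_branch alpha)] /\
  [/\ infinite_flexes alpha beta gamma delta =
        simple_fold_yw R `|` simple_fold_xz R,
      simple_fold_yw R <> simple_fold_xz R,
      diffeomorphic_to_circle (simple_fold_yw R) &
      diffeomorphic_to_circle (simple_fold_xz R)].
Proof.
subst beta gamma delta.
have s0 : sin alpha != 0 by rewrite gt_eqF// sin_gt0_pi.
have c0 : cos alpha != 0.
  (* On [[0, pi]] the cosine is injective, so it vanishes only at [pi / 2]. *)
  apply/eqP => c0; apply: alpha_neq; apply: cos_inj; last by rewrite cos_pihalf.
    by move: alpha_range => /andP[? ?]; rewrite in_itv/= !ltW.
  by rewrite in_itv/= divr_ge0 ?pi_ge0//= ler_pdivrMr// ler_peMr ?pi_ge0// ler1n.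
have flexesP x y z w := iff_trans (flexesE alpha x y z w)
  (rhombus_closedP _ _ x y z w c0 s0 (sin2cos2 alpha)).
split; split.
- rewrite -rhombus_branch_closure//; congr closure; apply/seteqP.
  split=> [[[[x y] z] w]|_ [t t0 ->]].
    case=> /flexesP[[t t0 [-> -> -> ->]] _|[-> _ _] []//|[-> _ _] []//].
    by exists t.
  split=> //; apply/flexesP; constructor 1; by exists t.
(* The two points added by completion, at [x = 0] and [x] infinite, are flexes because each lies on
   a simple fold. *)
- move=> _ [[t|] _ <-]; apply/flexesP => /=.
    have [->|t0] := eqVneq t 0; first by constructor 2; rewrite /= oppr0.
    by constructor 1; exists t.
  by constructor 3; rewrite /= oppr0.
- exact: rhombus_branch_circle.
- apply/seteqP; split=> [[[[x y] z] w]|_ [] [x _ <-]].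
  + case=> /flexesP[[t t0 [-> -> -> ->]]|[-> -> ->] _|[-> -> ->] _].
    * by case.
    * by left; exists x.
    * by right; exists y.
  + by split; [apply/flexesP; constructor 2|constructor 2].
  + by split; [apply/flexesP; constructor 3|constructor 1].
(* This configuration has finite [x], whereas the other fold has [x] infinite throughout. *)
- move=> E; have : simple_fold_yw R (Some 0, None, Some (- 0), None).
    by exists (Some 0).
  by rewrite E => -[].
- exact: simple_fold_yw_circle.
- exact: simple_fold_xz_circle.
Qed.
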